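(* Let $b$ be a prime, let $m,s,d,\alpha\in\mathbb{N}$, let $\boldsymbol{\gamma}=(\gamma_u)_{u\subseteq\{1,\ldots,s\}}$ be nonnegative real numbers, and let $p\in\mathbb{F}_b[x]$ be irreducible with $\deg(p)=m$. Suppose that $\boldsymbol{q}=(q_1,\ldots,q_{ds})$ is constructed by the component-by-component algorithm described in the context (i.e. $q_1=1$ and, for $\tau=2,\ldots,ds$, $q_\tau\in R_{b,m}$ minimizes $\tilde q_\tau\mapsto B_{\alpha,d,\boldsymbol{\gamma}}((\boldsymbol{q}_{\tau-1},\tilde q_\tau),p)$ over $R_{b,m}$). Then for every $\tau=1,\ldots,ds$, writing $\tau=(j_0-1)d+d_0$ with $j_0,d_0\in\mathbb{N}$ and $0<d_0\le d$, and for every real $\lambda$ with $1/(2\min(\alpha,d)+1)<\lambda\le 1$, we have $$B_{\alpha,d,\boldsymbol{\gamma}}(\boldsymbol{q}_\tau,p)\le \frac{1}{(b^m-1)^{1/\lambda}}\left[\sum_{\emptyset\ne u\subseteq\{1,\ldots,j_0-1\}}\gamma_u^\lambda C_{\alpha,d,\lambda,d}^{|u|}+C_{\alpha,d,\lambda,d_0}\sum_{u\subseteq\{1,\ldots,j_0-1\}}\gamma_{u\cup\{j_0\}}^\lambda C_{\alpha,d,\lambda,d}^{|u|}\right]^{1/\lambda},$$ where, for $a\in\mathbb{N}$, $$C_{\alpha,d,\lambda,a}=D_{\alpha,d}^\lambda\left(-1+(1+\tilde C_{\alpha,d,\lambda})^a\right),$$ $$\tilde C_{\alpha,d,\lambda}=\max\left\{\left(\frac{(b-1)^2}{b^\alpha(b^{2\min(\alpha,d)}-1)}\right)^\lambda,\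 \frac{(b-1)^{1+\lambda}}{b^{\lambda(\alpha-1)}(b^{(2\min(\alpha,d)+1)\lambda}-b)}\right\},$$ and $D_{\alpha,d}=4^{\max(d-\alpha,0)}b^{(2d-1)\alpha}$.
   Context: Notation. $\mathbb{F}_b$ is the field with $b$ elements, identified with $\{0,\ldots,b-1\}$. Each integer $0\le n<b^m$ with base-$b$ digits $n=\nu_0+\nu_1b+\cdots+\nu_{m-1}b^{m-1}$ is identified with the polynomial $n(x)=\nu_0+\nu_1x+\cdots+\nu_{m-1}x^{m-1}\in\mathbb{F}_b[x]$. The map $v_m:\mathbb{F}_b((x^{-1}))\to[0,1)$ is $v_m\left(\sum_{l=w}^\infty t_lx^{-l}\right)=\sum_{l=\max(1,w)}^m t_lb^{-l}$. $R_{b,m}=\{q\in\mathbb{F}_b[x]:\deg(q)<m,\ q\ne0\}$. For $1\le\tau\le ds$, $\boldsymbol{q}_\tau=(q_1,\ldots,q_\tau)$. An empty sum is $0$ and an empty product is $1$; the set $\{1,\ldots,0\}$ is empty. For $q_1,\ldots,q_\tau\in\mathbb{F}_b[x]$ put $z_{n,i}=v_m\left(n(x)q_i(x)/p(x)\right)\in[0,1)$ for $0\le n<b^m$, $1\le i\le\tau$ (the coordinates of a polynomial lattice point set). For $z\in[0,1)$ let $$\phi_{\alpha,d}(z)=\frac{(b-1)\left(b-1-b^{2\min(\alpha,d)\lfloor\log_bz\rfloor}(b^{2\min(\alpha,d)+1}-1)\right)}{b^\alpha(b^{2\min(\alpha,d)}-1)},$$ with the convention $b^{2\min(\alpha,d)\lfloor\log_b0\rfloor}=0$.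 Quality criterion. For $1\le\tau\le ds$ and $\beta=\lceil\tau/d\rceil$, with $D_{\alpha,d}=4^{\max(d-\alpha,0)}b^{(2d-1)\alpha}$, $$B_{\alpha,d,\boldsymbol{\gamma}}(\boldsymbol{q}_\tau,p)=\frac1{b^m}\sum_{n=0}^{b^m-1}\sum_{\emptyset\ne v\subseteq\{1,\ldots,\beta-1\}}\gamma_vD_{\alpha,d}^{|v|}\prod_{j\in v}\Big[-1+\prod_{k=1}^d(1+\phi_{\alpha,d}(z_{n,(j-1)d+k}))\Big]$$ $$+\frac1{b^m}\sum_{n=0}^{b^m-1}\sum_{\{\beta\}\subseteq v\subseteq\{1,\ldots,\beta\}}\gamma_vD_{\alpha,d}^{|v|}\prod_{j\in v\setminus\{\beta\}}\Big[-1+\prod_{k=1}^d(1+\phi_{\alpha,d}(z_{n,(j-1)d+k}))\Big]\Big[-1+\prod_{k=1}^{\tau-(\beta-1)d}(1+\phi_{\alpha,d}(z_{n,(\beta-1)d+k}))\Big].$$ Component-by-component algorithm. Given $b,s,d,m,\alpha,\boldsymbol{\gamma}$: (1) choose an irreducible $p\in\mathbb{F}_b[x]$ with $\deg(p)=m$; (2) set $q_1=1$; (3) for $\tau=2,\ldots,ds$, choose $q_\tau$ minimizing $B_{\alpha,d,\boldsymbol{\gamma}}((\boldsymbol{q}_{\tau-1},\tilde q_\tau),p)$ as a function of $\tilde q_\tau\in R_{b,m}$. *)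

(* Defs.v *)
From mathcomp Require Import all_boot all_order all_algebra.
From mathcomp Require Import reals exp.
From mathcomp Require Import zify.

Set Implicit Arguments.
Unset Strict Implicit.
Unset Printing Implicit Defensive.

Import Order.TTheory GRing.Theory Num.Theory.
Local Open Scope ring_scope.

(* F((x^-1)): the series \sum_(l >= w) t_l x^-l is given by its coefficients
   l |-> t_l, which vanish for l small enough. *)
Record laurent (F : fieldType) := Laurent {
  lcoef :> int -> F;
  lcoef_bounded : exists w : int, forall l : int, l < w -> lcoef l = 0 }.

(* Coefficient of x^-l in the polynomial a. *)
Definition poly_lcoef (F : fieldType) (a : {poly F}) (l : int) : F :=
  if l <= 0 then a`_(`|l|%N) else 0.

(* Coefficient of x^-l in the product of the polynomial p by the series t. *)
Definition mulp_lcoef (F : fieldType) (p : {poly F}) (t : laurent F) (l : int) : F :=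
  \sum_(i < size p) p`_i * t (l + i%:Z).

(* Coefficient of x^-l in a / p: it is the constant coefficient of the polynomial
   part of x^l a / p when l >= 0, and the coefficient of x^(-l) in the polynomial
   part of a / p when l < 0 (Negz k is - k.+1). *)
Definition divp_lcoef (F : fieldType) (a p : {poly F}) (l : int) : F :=
  match l with
  | Posz k => ((a * 'X^k) %/ p)`_0
  | Negz k => (a %/ p)`_k.+1
  end.

Lemma divp_lcoef_bounded (F : fieldType) (a p : {poly F}) :
  exists w : int, forall l : int, l < w -> divp_lcoef a p l = 0.
Proof.
exists (- (size (a %/ p)%R)%:Z) => -[k|k] lk /=.
  by exfalso; lia.
by apply: nth_default; apply: ltnW; move: lk; rewrite NegzE ltrN2 ltz_nat.
Qed.

Definition laurent_div (F : fieldType) (a p : {poly F}) : laurent F :=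
  Laurent (divp_lcoef_bounded a p).

Lemma coef_divpMX (F : fieldType) (a p : {poly F}) (N j : nat) : p != 0 ->
  ((a * 'X^(N.+1)) %/ p)`_j.+1 = ((a * 'X^N) %/ p)`_j.
Proof.
move=> p0; rewrite exprSr mulrA {1}(divp_eq (a * 'X^N) p) mulrDl mulrAC.
rewrite divpD mulpK // coefD coefMX /= [X in _ + X]nth_default ?addr0 //.
rewrite size_divp //.
have h1 : (size ((a * 'X^N) %% p)%R < size p)%N by rewrite ltn_modp.
have h2 := size_polyMleq ((a * 'X^N) %% p) 'X; rewrite size_polyX addn2 /= in h2.
have h3 := leq_trans h2 h1.
rewrite leq_subLR (leq_trans h3) // addnS -addSn prednK ?size_poly_gt0 //.
exact: leq_addr.
Qed.

Lemma divp_lcoefE (F : fieldType) (a p : {poly F}) (N : nat) (l : int) : p != 0 ->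
  l <= N%:Z -> divp_lcoef a p l = ((a * 'X^N) %/ p)`_(`|N%:Z - l|%N).
Proof.
move=> p0; have shift M j k : ((a * 'X^(M + k)) %/ p)`_(j + k) = ((a * 'X^M) %/ p)`_j.
  by elim: k => [|k IH]; rewrite ?addn0 // !addnS coef_divpMX.
case: l => k lk /=.
  rewrite -(shift k 0 (N - k)%N); congr ((_ * 'X^_) %/ _)`_ _; lia.
rewrite -[a %/ p]/((a) %/ p) -{1}[a]mulr1 -(expr0 'X) -(shift 0 k.+1 N).
congr ((_ * 'X^_) %/ _)`_ _; lia.
Qed.

(* laurent_div a p is the unique series whose product by p is a. *)
Lemma mulp_laurent_div (F : fieldType) (a p : {poly F}) (l : int) : p != 0 ->
  mulp_lcoef p (laurent_div a p) l = poly_lcoef a l.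
Proof.
move=> p0; pose N := (`|l| + 2 * size p)%N; pose k := `|N%:Z - l|%N.
have kE : k%:Z = N%:Z - l by rewrite /k /N; lia.
have ps : (size p <= k)%N by rewrite /k /N; lia.
have -> : mulp_lcoef p (laurent_div a p) l = (p * ((a * 'X^N) %/ p))`_k.
  rewrite coefM /mulp_lcoef.
  rewrite (big_ord_widen k.+1 (fun i => p`_i * laurent_div a p (l + i%:Z))); last lia.
  rewrite big_mkcond; apply: eq_bigr => i _; case: ltnP => ip; last first.
    by rewrite nth_default // mul0r.
  rewrite /= (@divp_lcoefE _ _ _ N) //; last by rewrite /N; lia.
  by congr (_ * _`_ _); lia.
have := congr1 (fun q : {poly F} => q`_k) (divp_eq (a * 'X^N) p).
rewrite /= coefD [X in _ + X]nth_default ?addr0; last first.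
  by apply: leq_trans ps; apply: ltnW; rewrite ltn_modp.
rewrite [p * _]mulrC => <-; rewrite coefMXn /poly_lcoef.
case: ltnP => kN; case: ifP => l0 //; try (exfalso; lia).
by congr _`_ _; lia.
Qed.

Lemma mulp_laurent_inj (F : fieldType) (p : {poly F}) (t u : laurent F) : p != 0 ->
  (forall l, mulp_lcoef p t l = mulp_lcoef p u l) -> forall l, t l = u l.
Proof.
move=> p0 tu; have [[wt ht] [wu hu]] := (lcoef_bounded t, lcoef_bounded u).
pose w := Num.min wt wu.
have low l : l < w -> t l = u l by rewrite lt_min => /andP[l1 l2]; rewrite ht ?hu.
have all k : forall l : int, l < w + k%:Z -> t l = u l.
  elim: k => [l|k IH l lk]; first by rewrite addr0; exact: low.
  case: (ltP l (w + k%:Z)) => [/IH //|kl].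
  have sp : (0 < size p)%N by rewrite size_poly_gt0.
  have := tu (l - (size p).-1%:Z); rewrite /mulp_lcoef.
  rewrite -(prednK sp) !big_ord_recr /= subrK.
  rewrite (eq_bigr (fun i : 'I_(size p).-1 => p`_i * u (l - (size p).-1%:Z + i%:Z))).
    move=> /addrI; apply: mulfI; by rewrite -lead_coefE lead_coef_eq0.
  move=> i _; rewrite IH //; have := ltn_ord i; move: (nat_of_ord i) => i'.
  by move: lk; move: (size p).-1 => sz; lia.
by move=> l; apply: (all `|l - w|.+1); lia.
Qed.

Definition v_map (R : realType) (b m : nat) (t : laurent 'F_b) : R :=
  \sum_(1 <= l < m.+1) (nat_of_ord (t l%:Z))%:R / b%:R ^+ l.

Definition digit_poly (b m n : nat) : {poly 'F_b} :=
  \poly_(i < m) ((n %/ b ^ i) %% b)%:R.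

Definition Rbm (b m : nat) : {pred {poly 'F_b}} :=
  [pred q : {poly 'F_b} | (size q <= m)%N && (q != 0)].
Arguments Rbm b m : clear implicits.

(* z_{n,i} for i >= 1; qs = [:: q_1; ...; q_tau], so that q_i is entry i - 1. *)
Definition lattice_coord (R : realType) (b m : nat) (p : {poly 'F_b})
    (qs : seq {poly 'F_b}) (n i : nat) : R :=
  v_map R m (laurent_div (digit_poly b m n * qs`_(i.-1)) p).

Definition phi (R : realType) (b alpha d : nat) (z : R) : R :=
  let mu := minn alpha d in
  let pw : R := if z == 0 then 0
    else b%:R ^ ((2 * mu)%:Z * Num.floor (ln z / ln b%:R)) in
  (b%:R - 1) * (b%:R - 1 - pw * (b%:R ^+ (2 * mu + 1) - 1))
    / (b%:R ^+ alpha * (b%:R ^+ (2 * mu) - 1)).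

(* The truncated subtraction d - alpha is max(d - alpha, 0). *)
Definition Dconst (R : realType) (b alpha d : nat) : R :=
  4 ^+ (d - alpha) * b%:R ^+ ((2 * d - 1) * alpha).

(* Throughout, {1, ..., s} is represented by 'I_s, with j : 'I_s standing for the
   integer j.+1. *)
Definition initial (s k : nat) : {set 'I_s} := [set j : 'I_s | (j.+1 <= k)%N].

(* The bracket -1 + \prod_(k = 1 .. a) (1 + phi (z_{n,(j-1)d+k})); z is the sequence
   z_{n,1}, z_{n,2}, ... and the 0-based block index j0 is j - 1. *)
Definition block (R : realType) (b alpha d : nat) (z : nat -> R) (j0 a : nat) : R :=
  - 1 + \prod_(1 <= k < a.+1) (1 + phi b alpha d (z (j0 * d + k)%N)).

Definition Bcrit (R : realType) (b m s d alpha : nat) (gamma : {set 'I_s} -> R)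
    (qs : seq {poly 'F_b}) (p : {poly 'F_b}) : R :=
  let tau := size qs in
  let beta := ((tau + d - 1) %/ d)%N in (* the ceiling of tau / d *)
  let sbeta := [set j : 'I_s | j.+1 == beta] in (* the singleton {beta} *)
  let z := lattice_coord R m p qs in
  let D := Dconst R b alpha d in
  (b%:R ^+ m)^-1 *
    (\sum_(0 <= n < b ^ m)
       \sum_(v : {set 'I_s} | (v != set0) && (v \subset initial s (beta - 1)))
         gamma v * D ^+ #|v| * \prod_(j in v) block b alpha d (z n) j d)
  + (b%:R ^+ m)^-1 *
    (\sum_(0 <= n < b ^ m)
       \sum_(v : {set 'I_s} | (sbeta \subset v) && (v \subset initial s beta))
         gamma v * D ^+ #|v|
         * (\prod_(j in v :\: sbeta) block b alpha d (z n) j d)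
         * block b alpha d (z n) (beta - 1) (tau - (beta - 1) * d)).

(* q = [:: q_1; ...; q_(ds)] is an output of the component-by-component algorithm;
   take tau q is (q_1, ..., q_tau). *)
Definition cbc_constructed (R : realType) (b m s d alpha : nat)
    (gamma : {set 'I_s} -> R) (p : {poly 'F_b}) (q : (d * s).-tuple {poly 'F_b}) : Prop :=
  q`_0 = 1 /\
  forall tau : nat, (2 <= tau <= d * s)%N ->
    q`_(tau.-1) \in Rbm b m /\
    forall q' : {poly 'F_b}, q' \in Rbm b m ->
      Bcrit m d alpha gamma (rcons (take tau.-1 q) q`_(tau.-1)) p
        <= Bcrit m d alpha gamma (rcons (take tau.-1 q) q') p.

Definition Ctilde (R : realType) (b alpha d : nat) (lambda : R) : R :=
  let mu := minn alpha d in
  Num.max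
    (((b%:R - 1) ^+ 2 / (b%:R ^+ alpha * (b%:R ^+ (2 * mu) - 1))) `^ lambda)
    ((b%:R - 1) `^ (1 + lambda)
      / (b%:R `^ (lambda * (alpha%:R - 1))
         * (b%:R `^ ((2 * mu + 1)%:R * lambda) - b%:R))).

Definition Cconst (R : realType) (b alpha d : nat) (lambda : R) (a : nat) : R :=
  Dconst R b alpha d `^ lambda * (- 1 + (1 + Ctilde b alpha d lambda) ^+ a).

(* Main.v *)
Require Import Defs.
From mathcomp Require Import all_boot all_order all_algebra.
From mathcomp Require Import qfpoly.
From mathcomp Require Import reals exp complex.
From mathcomp Require Import zify ring.

(* Put K = F_b[x]/(p) and fix a nontrivial additive character psi of K. As a function of
   the index n in K of a point, phi(z_(n,i)) is f (n q_i), where f is a sum of characters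
   k |-> psi(k n) with nonnegative coefficients c_k (the Walsh coefficients of phi). The
   functions with such an expansion form a semiring, their mean is the coefficient at 0,
   and by subadditivity of t |-> t^lambda the quantity \sum_k c_k^lambda is subadditive,
   submultiplicative and invariant under the dilations n |-> n q. Adding one component q to
   the criterion adds the mean of n |-> W(n) f (n q) with W independent of q; the average
   over q <> 0 of the lambda-th powers of these means is at most
   Ctilde / (b^m - 1) times \sum_k W_k^lambda, which also bounds the minimum. Summing these
   increments yields the bound, the recursion for the constants being
   C_(a+1) - C_a = D^lambda (1 + Ctilde)^a Ctilde. *)

Set Implicit Arguments.
Unset Strict Implicit.
Unset Printing Implicit Defensive.

Import Order.TTheory GRing.Theory Num.Theory.
Local Open Scope ring_scope.

(** * Nonnegative combinations of characters *)

(** For s = x + y > 0 and t = x or t = y, the ratio t / s lies in [0, 1], so t / s <= (t / s)^lam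
    because lam <= 1. Multiply by s^lam and add the two cases. *)
Lemma powR_subadd (R : realType) (lam x y : R) :
  lam <= 1 -> 0 <= x -> 0 <= y -> (x + y) `^ lam <= x `^ lam + y `^ lam.
Proof.
move=> l1 x0 y0; have [s0|s0] := eqVneq (x + y) 0.
  rewrite s0; have /andP[/eqP-> _] : (x == 0) && (y == 0) by rewrite -paddr_eq0 // s0.
  by rewrite lerDl powR_ge0.
have sp : 0 < x + y by rewrite lt_neqAle eq_sym s0 addr_ge0.
have key t : 0 <= t -> t <= x + y -> t / (x + y) * (x + y) `^ lam <= t `^ lam.
  move=> t0 ts; rewrite -[in leRHS](divfK s0 t) powRM ?divr_ge0 ?(ltW sp) //.
  apply: ler_wpM2r; first exact: powR_ge0.
  have [->|tn0] := eqVneq t 0; first by rewrite mul0r powR_ge0.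
  apply: ger1_powR => //; rewrite ler_pdivrMr // mul1r ts andbT.
  by rewrite divr_gt0 // lt_neqAle eq_sym tn0.
apply: le_trans (lerD (key x x0 _) (key y y0 _)); rewrite ?lerDl ?lerDr //.
by rewrite -mulrDl -mulrDl divff // mul1r.
Qed.

Lemma powR_subadd_sum (R : realType) (lam : R) (I : Type) (r : seq I) (P : pred I)
    (F : I -> R) : 0 < lam <= 1 -> (forall i, P i -> 0 <= F i) ->
  (\sum_(i <- r | P i) F i) `^ lam <= \sum_(i <- r | P i) F i `^ lam.
Proof.
case/andP=> l0 l1 F0.
suff [] : 0 <= \sum_(i <- r | P i) F i /\
  (\sum_(i <- r | P i) F i) `^ lam <= \sum_(i <- r | P i) F i `^ lam by [].
apply: (big_rec2 (fun x y => 0 <= y /\ y `^ lam <= x)) => [|i x y Pi [y0 yx]].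
  by split => //; rewrite powR0 // gt_eqF.
split; first by rewrite addr_ge0 ?F0.
by apply: le_trans (powR_subadd l1 (F0 i Pi) y0) _; rewrite lerD2l.
Qed.

Section Spectral.
Variables (R : realType) (C : fieldType) (iota : {rmorphism R -> C}).
Variables (K : finFieldType) (psi : K -> C) (lam : R).
Hypothesis psiD : forall x y, psi (x + y) = psi x * psi y.
Hypothesis psi0 : psi 0 = 1.
Hypothesis psi_orth : forall y, y != 0 -> \sum_k psi (k * y) = 0.
Hypothesis lam01 : 0 < lam <= 1.

(** Functions and coefficients stay in [R], where they can be compared and raised to powers; only
    the character sums live in [C]. *)
Definition expansion (g c : K -> R) : Prop :=
  (forall k, 0 <= c k) /\
  (forall n, iota (g n) = \sum_k iota (c k) * psi (k * n)).

Definition spectral (g : K -> R) (N : R) : Prop :=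
  exists2 c, expansion g c & \sum_k c k `^ lam <= N.

Lemma spectral_weaken g N N' : N <= N' -> spectral g N -> spectral g N'.
Proof. by move=> NN [c gc cN]; exists c => //; exact: le_trans NN. Qed.

Lemma eq_spectral g g' N : g =1 g' -> spectral g N -> spectral g' N.
Proof. by move=> gg [c [c0 gc] cN]; exists c => //; split=> // n; rewrite -gg. Qed.

Lemma lam_neq0 : lam != 0.
Proof. by case/andP: lam01 => l0 _; rewrite gt_eqF. Qed.

Lemma spectral_cst a : 0 <= a -> spectral (fun=> a) (a `^ lam).
Proof.
move=> a0; exists (fun k => if k == 0 then a else 0); first split.
- by move=> k; case: eqP.
- move=> n; rewrite (bigD1 0) //= eqxx mul0r psi0 mulr1 big1 ?addr0 // => k /negPf->.
  by rewrite rmorph0 mul0r.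
rewrite (bigD1 0) //= eqxx big1 ?addr0 // => k /negPf->.
by rewrite powR0 // lam_neq0.
Qed.

Lemma spectral0 : spectral (fun=> 0) 0.
Proof. by apply: spectral_weaken (spectral_cst (lexx 0)); rewrite powR0 // lam_neq0. Qed.

Lemma spectralD g h M N :
  spectral g M -> spectral h N -> spectral (fun n => g n + h n) (M + N).
Proof.
move=> [c [c0 gc] cM] [e [e0 he] eN].
exists (fun k => c k + e k); first split.
- by move=> k; rewrite addr_ge0.
- by move=> n; rewrite rmorphD gc he -big_split; apply: eq_bigr => k _; rewrite rmorphD mulrDl.
apply: le_trans (lerD cM eN); rewrite -big_split; apply: ler_sum => k _.
by apply: powR_subadd => //; case/andP: lam01.
Qed.

(** The characters of frequencies j and k - j multiply to the one of frequency k, so coefficients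
    are convolved. *)
Lemma expansionM g h c e : expansion g c -> expansion h e ->
  expansion (fun n => g n * h n) (fun k => \sum_j c j * e (k - j)).
Proof.
move=> [c0 gc] [e0 he]; split=> [k|n].
  by apply: sumr_ge0 => j _; rewrite mulr_ge0.
rewrite rmorphM gc he big_distrl /=.
under [RHS]eq_bigr => k _ do rewrite rmorph_sum mulr_suml.
rewrite exchange_big /=; apply: eq_bigr => j _.
rewrite mulr_sumr [RHS](reindex_inj (addIr j)) /=; apply: eq_bigr => k _.
by rewrite addrK mulrDl psiD rmorphM; ring.
Qed.

(** By subadditivity the powers of a convolution are dominated by the convolution of the powers,
    whose total over all frequencies factors. *)
Lemma spectralM g h M N :
  spectral g M -> spectral h N -> spectral (fun n => g n * h n) (M * N).
Proof.
move=> [c gc cM] [e he eN]; exists (fun k => \sum_j c j * e (k - j)).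
  exact: expansionM.
have [[c0 _] [e0 _]] := (gc, he).
apply: le_trans (_ : (\sum_k c k `^ lam) * (\sum_k e k `^ lam) <= _); last first.
  apply: ler_pM => //; apply: sumr_ge0 => k _; exact: powR_ge0.
rewrite big_distrl /=.
apply: le_trans (_ : \sum_k \sum_j c j `^ lam * e (k - j) `^ lam <= _).
  apply: ler_sum => k _.
  apply: le_trans (powR_subadd_sum _ lam01 _) _ => [j _|]; first by rewrite mulr_ge0.
  by apply: ler_sum => j _; rewrite powRM.
rewrite exchange_big /=; apply: ler_sum => j _.
rewrite -mulr_sumr [X in _ * X <= _](reindex_inj (addIr j)) /=.
by under eq_bigr do rewrite addrK.
Qed.

Lemma spectral_sum (I : Type) (r : seq I) (P : pred I) (g : I -> K -> R) (N : I -> R) :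
  (forall i, P i -> spectral (g i) (N i)) ->
  spectral (fun n => \sum_(i <- r | P i) g i n) (\sum_(i <- r | P i) N i).
Proof.
move=> gN; elim: r => [|i r IH].
  by rewrite big_nil; apply: eq_spectral spectral0 => n; rewrite big_nil.
rewrite big_cons; case: ifP => Pi.
  by apply: eq_spectral (spectralD (gN i Pi) IH) => n; rewrite big_cons Pi.
by apply: eq_spectral IH => n; rewrite big_cons Pi.
Qed.

Lemma spectral_prod (I : Type) (r : seq I) (P : pred I) (g : I -> K -> R) (N : I -> R) :
  (forall i, P i -> spectral (g i) (N i)) ->
  spectral (fun n => \prod_(i <- r | P i) g i n) (\prod_(i <- r | P i) N i).
Proof.
move=> gN; elim: r => [|i r IH].
  have := spectral_cst ler01; rewrite powR1 big_nil; apply: eq_spectral => n.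
  by rewrite big_nil.
rewrite big_cons; case: ifP => Pi.
  by apply: eq_spectral (spectralM (gN i Pi) IH) => n; rewrite big_cons Pi.
by apply: eq_spectral IH => n; rewrite big_cons Pi.
Qed.

(** Dilation by q sends frequency k to k q, so it only permutes the coefficients. *)
Lemma expansion_dilate f c q : q != 0 -> expansion f c ->
  expansion (fun n => f (n * q)) (fun k => c (k / q)).
Proof.
move=> q0 [c0 fc]; split=> // n; rewrite fc [RHS](reindex_inj (mulIf q0)) /=.
by apply: eq_bigr => k _; rewrite mulfK // mulrA mulrAC.
Qed.

Lemma spectral_dilate f N q : q != 0 -> spectral f N -> spectral (fun n => f (n * q)) N.
Proof.
move=> q0 [c fc cN]; exists (fun k => c (k / q)); first exact: expansion_dilate.
by rewrite (reindex_inj (mulIf q0)) /=; under eq_bigr do rewrite mulfK //.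
Qed.

Definition mean (g : K -> R) : R := #|K|%:R^-1 * \sum_n g n.

(** By orthogonality every nonzero frequency averages to 0. *)
Lemma mean_expansion g c : expansion g c -> mean g = c 0.
Proof.
move=> [c0 gc]; have K0 : #|K|%:R != 0 :> R by rewrite pnatr_eq0 -lt0n; apply/card_gt0P; exists 0.
apply: (mulfI K0); rewrite /mean mulVKf //; apply: (fmorph_inj iota).
rewrite rmorph_sum; under eq_bigr do rewrite gc.
rewrite exchange_big /= (bigD1 0) //= [X in _ + X]big1 => [|k k0].
  under eq_bigr do rewrite mul0r psi0 mulr1.
  by rewrite sumr_const addr0 rmorphM rmorph_nat mulr_natl.
by rewrite -mulr_sumr; under eq_bigr do rewrite mulrC; rewrite psi_orth // mulr0.
Qed.

Lemma spectral_mean_ge0 g N : spectral g N -> 0 <= mean g.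
Proof. by case=> c gc _; rewrite (mean_expansion gc); case: gc. Qed.

Lemma mean_mul g f c e : expansion g c -> expansion f e ->
  mean (fun n => g n * f n) = \sum_k c k * e (- k).
Proof.
move=> gc fe; under eq_bigr do rewrite -sub0r.
exact: mean_expansion (expansionM gc fe).
Qed.

(* A fixed nonzero frequency [k] of [g] meets every nonzero frequency of [f] exactly
   once as [q] runs over the nonzero elements, whereas the zero frequencies always meet. *)
Lemma average_dilates g f N c A : expansion f c ->
  #|K|.-1%:R * c 0 `^ lam <= A -> \sum_(k | k != 0) c k `^ lam <= A ->
  spectral g N ->
  \sum_(q | q != 0) mean (fun n => g n * f (n * q)) `^ lam <= N * A.
Proof.
move=> fc A0 A1 [e [e0 ge] eN]; have [c0 _] := fc.
apply: le_trans (_ : \sum_(q | q != 0) \sum_k e k `^ lam * c (- k / q) `^ lam <= _).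
  apply: ler_sum => q q0; rewrite (mean_mul (conj e0 ge) (expansion_dilate q0 fc)).
  apply: le_trans (powR_subadd_sum _ lam01 _) _ => [k _|]; first by rewrite mulr_ge0.
  by apply: ler_sum => k _; rewrite powRM.
rewrite exchange_big /=.
have Age0 : 0 <= A by apply: le_trans A1; apply: sumr_ge0 => k _; exact: powR_ge0.
apply: le_trans (_ : \sum_k e k `^ lam * A <= _); last first.
  by rewrite -mulr_suml ler_wpM2r.
apply: ler_sum => k _; rewrite -mulr_sumr; apply: ler_wpM2l; first exact: powR_ge0.
(* Frequency 0 of [g] meets the coefficient [c 0] for each of the [#|K|.-1] dilations, which is what
   the first bound on [A] pays for. *)
have [->|k0] := eqVneq k 0.
  under eq_bigr do rewrite oppr0 mul0r.
  by rewrite sumr_const cardC1 -mulr_natl.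
apply: le_trans A1; rewrite le_eqVlt; apply/orP; left; apply/eqP.
(* This map is an involution of [K], fixing 0 since 0 inverts to 0, and it turns [c (- k / q)] into
   [c q]. *)
rewrite (reindex (fun q => - k / q)) /=; last first.
  exists (fun q => - k / q) => q _; rewrite invf_div mulrC mulfVK ?oppr_eq0 //.
apply: eq_big => [q|q _]; first by rewrite mulf_eq0 oppr_eq0 (negPf k0) invr_eq0.
by rewrite invf_div mulrC mulfVK ?oppr_eq0.
Qed.

End Spectral.

(** * The residue field F_b[x]/(p) *)

(** A root of 1 + X + ... + X^(b-1) has order dividing b; order 1 would mean that the root is 1 and
    b = 0 in [C]. *)
Lemma prime_primitive_root (C : closedFieldType) (b : nat) :
  prime b -> b%:R != 0 :> C -> exists zeta : C, b.-primitive_root zeta.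
Proof.
move=> pb b0; have b1 := prime_gt1 pb.
have [|z /rootP zr] := closed_rootP (\poly_(i < b) (1 : C)) _.
  by rewrite size_poly_eq ?oner_eq0 // neq_ltn b1 orbT.
have geo : \sum_(i < b) z ^+ i = 0.
  by rewrite -[RHS]zr horner_poly; apply: eq_bigr => i _; rewrite mul1r.
have zb : z ^+ b = 1 by apply/eqP; rewrite -subr_eq0 subrX1 geo mulr0.
have [k zk kb] := prim_order_exists (prime_gt0 pb) zb.
have [k1|k1] := eqVneq k 1%N; last first.
  by move: pb => /primeP[_ /(_ _ kb)]; rewrite (negPf k1) /= => /eqP<-; exists z.
have z1 : z = 1 by rewrite -[z]expr1 -k1; exact: prim_expr_order zk.
move: geo; rewrite z1; under eq_bigr do rewrite expr1n.
by rewrite sumr_const card_ord => /eqP; rewrite (negPf b0).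
Qed.

(** The quotient is formed with the monic multiple of [p], which has the same remainders. The rest
    of the proof uses only the two equations on [red] and [rep]. *)
Lemma residue_field (F : finFieldType) (p : {poly F}) : irreducible_poly p ->
  exists (K : finFieldType) (red : {rmorphism {poly F} -> K}) (rep : K -> {poly F}),
    cancel rep red /\ forall a, rep (red a) = a %% p.
Proof.
move=> hp; have p0 := irredp_neq0 hp.
have l0 : (lead_coef p)^-1 != 0 by rewrite invr_eq0 lead_coef_eq0.
pose h := (lead_coef p)^-1 *: p.
have hm : h \is monic by rewrite monicE lead_coefZ mulVf // lead_coef_eq0.
have hI : monic_irreducible_poly h.
  split=> //; case: hp => sp ip; split; first by rewrite size_scale.
  move=> q q1 qh; apply: eqp_trans (ip _ q1 _) _; first by rewrite -(dvdpZr _ _ l0).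
  by rewrite eqp_sym eqp_scale.
exists {poly %/ h with hI}, (in_qpoly h), (fun k : {poly %/ h} => k : {poly F}).
have hh : mk_monic h = h by rewrite /mk_monic !hI.
split=> [k|a]; first by apply/val_inj/in_qpoly_small/size_mk_monic.
by rewrite /= hh -Pdiv.IdomainMonic.modpE // modpZr.
Qed.

Section ResidueField.
Variables (b m : nat) (p : {poly 'F_b}).
Variables (K : finFieldType) (red : {rmorphism {poly 'F_b} -> K}) (rep : K -> {poly 'F_b}).
Hypotheses (hb : prime b) (hm : (0 < m)%N) (hdeg : size p = m.+1).
Hypotheses (repK : cancel rep red) (redK : forall a, rep (red a) = a %% p).

Let p0 : p != 0. Proof. by rewrite -size_poly_eq0 hdeg. Qed.

Lemma size_rep k : (size (rep k) <= m)%N.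
Proof. by rewrite -(repK k) redK -ltnS -hdeg ltn_modp. Qed.

Lemma red_small (a : {poly 'F_b}) : (size a <= m)%N -> rep (red a) = a.
Proof. by move=> am; rewrite redK modp_small // hdeg ltnS. Qed.

Lemma repD x y : rep (x + y) = rep x + rep y.
Proof.
by rewrite -{1}(repK x) -{1}(repK y) -rmorphD redK modpD !modp_small // hdeg ltnS size_rep.
Qed.

Lemma rep0 : rep 0 = 0.
Proof. by rewrite -(rmorph0 red) red_small // size_poly0. Qed.

Lemma repN x : rep (- x) = - rep x.
Proof. by apply/eqP; rewrite -addr_eq0 -repD addNr rep0. Qed.

(** For a <= m a polynomial of degree less than a is its own remainder, so [red] embeds these b^a
    polynomials into [K]. *)
Lemma card_small_rep a : (a <= m)%N -> #|[pred k | (size (rep k) <= a)%N]| = (b ^ a)%N.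
Proof.
move=> am; pose f (v : {poly_a 'F_b}) : K := red (val v).
have fK v : rep (f v) = val v by rewrite red_small // (leq_trans (size_npoly v)).
have fi : injective f by move=> u v uv; apply: val_inj; rewrite -!fK uv.
have := card_npoly 'F_b a; rewrite card_Fp // => <-; rewrite -(card_codom fi).
apply: eq_card => k; rewrite !inE; apply/idP/codomP => [ka|[v ->]].
  by exists (npolyp a (rep k)); rewrite /f /= npolypK // repK.
by rewrite fK size_npoly.
Qed.

Lemma card_residue_field : #|K| = (b ^ m)%N.
Proof.
by rewrite -(card_small_rep (leqnn m)); apply: eq_card => k; rewrite !inE size_rep.
Qed.

(** For 1 <= l <= m this is the l-th base-b digit of v_m(a / p). *)
Definition digit (l : nat) (a : {poly 'F_b}) : 'F_b := laurent_div a p l%:Z.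

Lemma digitD l a c : digit l (a + c) = digit l a + digit l c.
Proof. by rewrite /digit /= mulrDl divpD coefD. Qed.

Lemma digitZ l x a : digit l (x *: a) = x * digit l a.
Proof. by rewrite /digit /= -scalerAl divpZl coefZ. Qed.

(** Reduction modulo [p] changes a / p by a polynomial, which has no terms of negative degree.
    Digits are thus functions on the residue field. *)
Lemma digit_modp l a : (0 < l)%N -> digit l (a %% p) = digit l a.
Proof.
case: l => // l _; rewrite {2}(divp_eq a p) digitD; rewrite [X in _ = X + _]/digit /=.
by rewrite mulrAC mulpK // coefMXn add0r.
Qed.

Lemma digit_shift l a : digit l.+1 a = digit 1 ('X^l * a).
Proof. by rewrite /digit /= expr1 exprSr mulrA [_ * a]mulrC. Qed.

(** Since [p] has degree m, the series of x^(m-1) / p starts at x^-1. This makes [psi]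
    nontrivial. *)
Lemma digit1_neq0 : digit 1 'X^(m.-1) != 0.
Proof.
rewrite /digit /= expr1 -exprSr prednK //.
have s1 : size ('X^m %/ p : {poly 'F_b}) = 1%N by rewrite size_divp // size_polyXn hdeg /= subSnn.
by have := lead_coefE ('X^m %/ p); rewrite s1 /= => <-; rewrite lead_coef_eq0 -size_poly_eq0 s1.
Qed.

Variables (C : fieldType) (zeta : C).
Hypothesis zeta_prim : b.-primitive_root zeta.

(** The coefficient of x^-1 is an F_b-linear form on [K]; it is composed with the additive character
    t |-> zeta^t of F_b. *)
Definition psi (k : K) : C := zeta ^+ (digit 1 (rep k)).

Lemma psiD x y : psi (x + y) = psi x * psi y.
Proof.
rewrite /psi repD digitD -exprD -(prim_expr_mod zeta_prim (_ + _)%N).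
by congr (_ ^+ _); rewrite /= [X in (_ %% X)%N = _]Fp_cast.
Qed.

Lemma psi0 : psi 0 = 1.
Proof.
by rewrite /psi rep0 /digit /= mul0r div0p coef0.
Qed.

Lemma psi_eq1 k : (psi k == 1) = (digit 1 (rep k) == 0).
Proof.
rewrite /psi -(prim_order_dvd zeta_prim) -(inj_eq val_inj) /=.
have : (digit 1 (rep k) < b)%N by rewrite -[X in (_ < X)%N](Fp_cast hb) ltn_ord.
by rewrite /dvdn => /modn_small->.
Qed.

(** As k y runs over [K], translating by an x with psi(x) <> 1 preserves the sum and also multiplies
    it by psi(x). *)
Lemma psi_orth y : y != 0 -> \sum_k psi (k * y) = 0.
Proof.
move=> y0; rewrite (reindex_inj (mulIf (invr_neq0 y0))) /=.
under eq_bigr do rewrite mulfVK //.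
pose x := red 'X^(m.-1); apply/eqP.
have x1 : psi x != 1.
  by rewrite psi_eq1 red_small ?digit1_neq0 // size_polyXn prednK.
have : \sum_k psi k = psi x * \sum_k psi k.
  by rewrite {1}(reindex_inj (addrI x)) mulr_sumr; apply: eq_bigr => k _; rewrite psiD.
move/eqP; rewrite -{1}[\sum_k _]mul1r -subr_eq0 -mulrBl mulf_eq0 subr_eq0 eq_sym.
by rewrite (negPf x1).
Qed.

(** Multiplication by x^i moves digit i + 1 to place 1. Hence k |-> [psi (k * y)] evaluates the
    Walsh functions at the point whose digits are those of y. *)
Lemma digit1M k y :
  digit 1 (rep (k * y)) = \sum_(i < size (rep k)) (rep k)`_i * digit i.+1 (rep y).
Proof.
rewrite -{1}(repK k) -{1}(repK y) -rmorphM redK digit_modp //.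
rewrite -{1}[rep k]coefK poly_def mulr_suml.
have digit0 : digit 1 0 = 0 by rewrite /digit /= mul0r div0p coef0.
rewrite (big_morph (digit 1) (digitD 1) digit0); apply: eq_bigr => i _.
by rewrite -scalerAl digitZ -digit_shift.
Qed.

(** The residues of size at most a form a subgroup. The character is trivial on it when the first a
    digits of y vanish; otherwise a nonzero digit i + 1 gives x^i as a translation that forces the
    sum to be 0. *)
Lemma psi_sum_small a y : (a <= m)%N ->
  \sum_(k | (size (rep k) <= a)%N) psi (k * y)
  = (if [forall i : 'I_a, digit i.+1 (rep y) == 0] then (b ^ a)%N else 0%N)%:R.
Proof.
move=> am; case: ifPn => [/forallP y0|/forallPn[i yi]].
  under eq_bigr => k ka.
    have /eqP-> : psi (k * y) == 1.
      rewrite psi_eq1 digit1M big1 // => i _.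
      by have /eqP-> := y0 (widen_ord ka i); rewrite mulr0.
    over.
  by rewrite sumr_const card_small_rep.
pose x := red 'X^i; have ix : size (rep x) = i.+1.
  by rewrite red_small size_polyXn // (leq_trans _ am).
have x1 : psi (x * y) != 1.
  rewrite psi_eq1 /x -{1}(repK y) -rmorphM redK digit_modp // -digit_shift //.
have xa (k : K) : (size (rep (x + k)%R) <= a)%N = (size (rep k) <= a)%N.
  have le (u v : K) : (size (rep u) <= a)%N -> (size (rep v) <= a)%N ->
      (size (rep (u + v)%R) <= a)%N.
    by move=> ua va; rewrite repD (leq_trans (size_polyD _ _)) // geq_max ua va.
  have xia : (size (rep x) <= a)%N by rewrite ix.
  apply/idP/idP => [|/(le _ _ xia) //].
  by rewrite -{2}(addKr x k); apply: le; rewrite repN size_polyN.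
have : \sum_(k | (size (rep k) <= a)%N) psi (k * y)
     = psi (x * y) * \sum_(k | (size (rep k) <= a)%N) psi (k * y).
  rewrite {1}(reindex_inj (addrI x)) mulr_sumr; apply: eq_big => [k|k _]; first exact: xa.
  by rewrite mulrDl psiD.
move/eqP; rewrite -{1}[\sum_(_ | _) _]mul1r -subr_eq0 -mulrBl mulf_eq0 subr_eq0 eq_sym.
by rewrite (negPf x1) => /eqP.
Qed.

(** The layer of size a is written as a difference of two subgroups, because sums over these
    subgroups are what [psi_sum_small] and [card_small_rep] evaluate. *)
Lemma sum_by_size (V : pzRingType) (w : nat -> V) (G : K -> V) :
  \sum_(k | k != 0) w (size (rep k)) * G k
  = \sum_(1 <= a < m.+1) w a *
      (\sum_(k | (size (rep k) <= a)%N) G k - \sum_(k | (size (rep k) <= a.-1)%N) G k).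
Proof.
have rep_eq0 k : (size (rep k) == 0) = (k == 0).
  by rewrite size_poly_eq0; apply/eqP/eqP => [k0|->]; rewrite ?rep0 // -(repK k) k0 rmorph0.
have split_size (n : nat) (P : pred K) (H : K -> V) :
    \sum_(k | P k && (size (rep k) <= n.+1)%N) H k =
    \sum_(k | P k && (size (rep k) <= n)%N) H k + \sum_(k | P k && (size (rep k) == n.+1)) H k.
  rewrite (bigID [pred k | (size (rep k) <= n)%N]) /=; congr (_ + _); apply: eq_bigl => k.
    by rewrite -andbA; case: (leqP (size (rep k)) n) => kn; rewrite ?andbF // leqW.
  by rewrite -andbA -ltnNge eqn_leq.
(* The bound by m holds for every k; it is inserted so that the induction can vary it. *)
transitivity (\sum_(k | (k != 0) && (size (rep k) <= m)%N) w (size (rep k)) * G k).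
  by apply: eq_bigl => k; rewrite size_rep andbT.
elim: m => [|n IH].
  rewrite big_geq // big_pred0 // => k.
  by rewrite leqn0 rep_eq0 andNb.
rewrite split_size IH [RHS]big_nat_recr //=; congr (_ + _).
rewrite (split_size n xpredT) /= addrAC subrr add0r mulr_sumr.
apply: eq_big => [k|k /andP[_ /eqP->] //].
by case: (eqVneq k 0) => //= ->; rewrite rep0 size_poly0.
Qed.

End ResidueField.

(** * Walsh expansion of phi on m-digit numbers *)

Section PhiExpansion.
Variables (R : realType) (b m alpha d : nat).
Hypotheses (b_gt1 : (1 < b)%N) (alpha_gt0 : (0 < alpha)%N) (d_gt0 : (0 < d)%N).

Local Notation B := (b%:R : R).
Local Notation X := (B ^+ (2 * minn alpha d)).

Let B1 : 1 < B. Proof. by rewrite ltr1n. Qed.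
Let B0 : 0 < B. Proof. exact: lt_trans B1. Qed.
Let X1 : 1 < X. Proof. by rewrite exprn_egt1 // muln_eq0 /= -lt0n leq_min alpha_gt0. Qed.
Let X0 : 0 < X. Proof. exact: lt_trans X1. Qed.

Definition phi0 : R := (B - 1) ^+ 2 / (B ^+ alpha * (X - 1)).

(* The Walsh coefficient of [phi] at the integers [b ^ (a - 1) <= k < b ^ a]. *)
Definition walsh_coef (a : nat) : R := ((B - 1) * B / B ^+ alpha) / (X * B) ^+ a.

(* The sum of the Walsh coefficients of [phi] at the nonzero multiples of [b ^ m], where
   the Walsh functions are constant on numbers with [m] digits. *)
Definition alias_coef : R := phi0 / (X * B) ^+ m.

Lemma phi0_gt0 : 0 < phi0.
Proof. by rewrite divr_gt0 ?exprn_gt0 ?mulr_gt0 ?exprn_gt0 ?subr_gt0. Qed.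

Lemma walsh_coef_gt0 a : 0 < walsh_coef a.
Proof. by rewrite !divr_gt0 ?mulr_gt0 ?exprn_gt0 ?mulr_gt0 ?subr_gt0. Qed.

Lemma alias_coef_gt0 : 0 < alias_coef.
Proof. by rewrite divr_gt0 ?phi0_gt0 ?exprn_gt0 ?mulr_gt0. Qed.

Lemma phi_at0 : phi b alpha d (0 : R) = phi0.
Proof. by rewrite /phi /phi0 eqxx mul0r subr0 expr2. Qed.

Lemma phi_floor (c : nat) (z : R) : B ^- c.+1 <= z < B ^- c ->
  phi b alpha d z = (B - 1) * (B - 1 - X ^- c.+1 * (X * B - 1)) / (B ^+ alpha * (X - 1)).
Proof.
case/andP=> cz zc; have z0 : 0 < z by apply: lt_le_trans cz; rewrite invr_gt0 exprn_gt0.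
have lB : 0 < ln B by rewrite ln_gt0.
have lnB k : ln (B ^- k) = - (k%:R * ln B).
  by rewrite lnV ?posrE ?exprn_gt0 // lnXn // mulr_natl.
have fl : Num.floor (ln z / ln B) = - c.+1%:Z.
  apply: floor_def; rewrite ler_pdivlMr // ltr_pdivrMr // rmorphD /= !mulrNz.
  have -> : - c.+1%:~R + 1 = - c%:R :> R by rewrite -pmulrn -natr1; ring.
  by rewrite !mulNr -!lnB ler_ln ?ltr_ln ?posrE ?invr_gt0 ?exprn_gt0 // cz zc.
rewrite /phi gt_eqF // fl exprD expr1; congr (_ * (_ - _ * _) / _).
by rewrite -exprz_exp -exprnP exprnN.
Qed.

Lemma digit_sum_bounds (t : nat -> nat) (c : nat) : (forall l, t l < b)%N -> (c < m)%N ->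
  (forall i : 'I_c, t i.+1 = 0) -> t c.+1 != 0 ->
  B ^- c.+1 <= \sum_(1 <= l < m.+1) (t l)%:R / B ^+ l < B ^- c.
Proof.
move=> tb cm t0 tc.
have -> : \sum_(1 <= l < m.+1) (t l)%:R / B ^+ l = \sum_(c.+1 <= l < m.+1) (t l)%:R / B ^+ l.
  rewrite (@big_cat_nat _ _ _ c.+1) //=; last by rewrite ltnS ltnW.
  rewrite big_nat big1 ?add0r // => -[//|l] /andP[_ lc].
  by rewrite (t0 (Ordinal (lc : (l < c)%N))) mul0r.
apply/andP; split.
  rewrite big_ltn // -[leLHS]addr0 lerD ?sumr_ge0 // => [|l _].
    by rewrite ler_peMl ?invr_ge0 ?exprn_ge0 ?(ltW B0) // ler1n lt0n.
  by rewrite divr_ge0 ?exprn_ge0 ?(ltW B0).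
(* Each digit is at most b - 1, and (b - 1) b^-l = b^-(l-1) - b^-l telescopes to b^-c - b^-m. *)
apply: le_lt_trans (_ : \sum_(c.+1 <= l < m.+1) (- B ^- l - - B ^- l.-1) < _).
  rewrite big_nat [leRHS]big_nat; apply: ler_sum => -[//|l] _ /=.
  have tl : (t l.+1)%:R <= B - 1 by rewrite lerBrDr natr1 ler_nat.
  rewrite opprK addrC (_ : _ - _ = (B - 1) / B ^+ l.+1).
    by rewrite ler_wpM2r // invr_ge0 exprn_ge0 // ltW.
  by rewrite exprS; field; rewrite expf_neq0 gt_eqF.
rewrite (telescope_sumr (fun l => - B ^- l.-1)) /= ?ltnS ?(ltnW cm) //.
rewrite opprK -[ltRHS]add0r ltrD2r.
by rewrite oppr_lt0 invr_gt0 exprn_gt0.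
Qed.

(** There are b^a - b^(a-1) integers with exactly a digits, so the terms are geometric of ratio 1 /
    [X]. *)
Lemma sum_walsh_coef n :
  \sum_(1 <= a < n.+1) walsh_coef a * (B ^+ a - B ^+ a.-1) = phi0 * (1 - X ^- n).
Proof.
have [Bn0 Xn0] : B != 0 /\ X != 0 by rewrite !gt_eqF.
have Xn1 : X - 1 != 0 by rewrite gt_eqF // subr_gt0.
elim: n => [|n IH]; first by rewrite big_geq // expr0 invr1 subrr mulr0.
rewrite big_nat_recr //= IH /walsh_coef /phi0 exprMn !exprS.
by field; rewrite Bn0 Xn1 !expf_neq0.
Qed.

(* The factor [if .. then .. else 0] is the sum of the first [b ^ a] Walsh functions. *)
Lemma phi_digits (t : nat -> nat) : (forall l, t l < b)%N ->
  let s a : R := (if [forall i : 'I_a, t i.+1 == 0] then (b ^ a)%N else 0%N)%:R in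
  phi b alpha d (\sum_(1 <= l < m.+1) (t l)%:R / B ^+ l) =
  \sum_(1 <= a < m.+1) walsh_coef a * (s a - s a.-1) + alias_coef * s m.
Proof.
move=> tb s; have [Bn0 Xn0] : B != 0 /\ X != 0 by rewrite !gt_eqF.
have Xn1 : X - 1 != 0 by rewrite gt_eqF // subr_gt0.
have s_zero n a : (forall i : 'I_n, t i.+1 = 0) -> (a <= n)%N -> s a = B ^+ a.
  move=> t0 an; rewrite /s; case: forallP => [_|[]]; first by rewrite natrX.
  by move=> i; rewrite (t0 (widen_ord an i)).
(* At the point 0 all layers are full and sum to phi0 (1 - X^-m); the alias term supplies the
   missing phi0 X^-m. *)
case: (boolP [forall i : 'I_m, t i.+1 == 0]) => [/forallP t0|tn0].
  have {}t0 (i : 'I_m) : t i.+1 = 0 by exact/eqP.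
  rewrite big_nat big1 => [|[//|l] lm]; last by rewrite (t0 (Ordinal (lm : (l < m)%N))) mul0r.
  rewrite phi_at0 big_nat.
  under eq_bigr => a /andP[a1 am] do
    rewrite (s_zero m a) // (s_zero m a.-1) // ?(leq_trans (leq_pred a)) //.
  rewrite -big_nat sum_walsh_coef (s_zero m m) // /alias_coef exprMn.
  by field; rewrite !expf_neq0.
have [c /andP[cm tc] cmin] : exists2 c, (c < m)%N && (t c.+1 != 0)
    & forall i, (i < m)%N && (t i.+1 != 0) -> (c <= i)%N.
  have ex : exists i, (i < m)%N && (t i.+1 != 0).
    by move: tn0; rewrite negb_forall => /existsP[i ti]; exists i; rewrite ltn_ord.
  by case: (ex_minnP ex) => c; exists c.
have t0 (i : 'I_c) : t i.+1 = 0.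
  apply/eqP/negPn/negP => ti; have := cmin i; rewrite ti (ltn_trans _ cm) // => /(_ isT).
  by rewrite leqNgt ltn_ord.
have s_big a : (c < a)%N -> s a = 0.
  by move=> ca; rewrite /s; case: forallP => // /(_ (Ordinal ca)); rewrite (negPf tc).
(* With exactly c leading zeros, layers up to c are full, layer c + 1 contributes -b^c, and all
   later ones vanish. *)
rewrite (phi_floor (digit_sum_bounds tb cm t0 tc)) s_big // mulr0 addr0.
rewrite (@big_cat_nat _ _ _ c.+1) //=; last by rewrite ltnS ltnW.
rewrite [X in _ = X + _]big_nat.
under [X in _ = X + _]eq_bigr => a /andP[a1 am].
  rewrite (s_zero c a) // (s_zero c a.-1) // ?(leq_trans (leq_pred a)) //; over.
rewrite -big_nat sum_walsh_coef big_ltn //= [X in _ + (_ + X)]big_nat big1; last first.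
  by move=> [//|a] /andP[ca _]; rewrite !s_big ?subrr ?mulr0 //= ltnW.
rewrite s_big // (s_zero c c) // addr0 sub0r /walsh_coef /phi0 exprMn !exprS.
by field; rewrite Bn0 Xn1 !expf_neq0.
Qed.

Section PowerSum.
Variable lambda : R.
Hypothesis lam_gt : 1 / (2 * minn alpha d + 1)%:R < lambda.

Let lam0 : 0 < lambda. Proof. by apply: le_lt_trans lam_gt; rewrite divr_ge0. Qed.
Let Q : R := (X * B) `^ lambda.

Let QE : Q = B `^ ((2 * minn alpha d + 1)%:R * lambda).
Proof. by rewrite /Q -exprSr -addn1 powRrM powR_mulrn // ltW. Qed.

(** The lower bound on lambda says precisely this; it makes the series of lambda-th powers
    converge. *)
Let BQ : B < Q.
Proof.
rewrite QE -[ltLHS]powRr1 ?(ltW B0) //; rewrite /powR gt_eqF // ltr_expR ltr_pM2r ?ln_gt0 //.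
by rewrite mulrC -ltr_pdivrMr // ltr0n addn1.
Qed.

Let powR_frac (x : R) a : 0 <= x -> (x / (X * B) ^+ a) `^ lambda = x `^ lambda / Q ^+ a.
Proof.
move=> x0; have XB0 : 0 <= X * B by rewrite mulr_ge0 // ltW.
rewrite powRM ?invr_ge0 ?exprn_ge0 // -powR_inv1 ?exprn_ge0 // powRAC.
by rewrite powR_inv1 ?powR_ge0 // -powR_mulrn // powRAC powR_mulrn ?powR_ge0.
Qed.

Lemma phi0_powR_le : phi0 `^ lambda <= Ctilde b alpha d lambda.
Proof. by rewrite le_max lexx. Qed.

(** The sum of the infinite series of lambda-th powers of the Walsh coefficients; [T_le] finds it
    equal to the second entry of the maximum in [Ctilde]. *)
Let T : R := ((B - 1) * B / B ^+ alpha) `^ lambda * (B - 1) / (Q - B).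

Let T_le : T <= Ctilde b alpha d lambda.
Proof.
rewrite le_max; apply/orP; right; rewrite le_eqVlt; apply/orP; left; apply/eqP.
have Bm1 : 0 <= B - 1 by rewrite subr_ge0 ltW.
have BV : B / B ^+ alpha = B `^ (- (alpha%:R - 1)).
  rewrite opprB powRB; last by rewrite (gt_eqF B0) implybT.
  by rewrite powRr1 ?powR_mulrn ?ltW.
rewrite /T -QE -(mulrA (B - 1) B) powRM // ?divr_ge0 ?exprn_ge0 ?(ltW B0) // BV -powRrM mulNr powRN.
rewrite [_ * lambda]mulrC powRD ?powRr1 //; last first.
  by rewrite gt_eqF // addr_gt0.
by rewrite invfM; ring.
Qed.

Let sum_T n :
  \sum_(1 <= a < n.+1) walsh_coef a `^ lambda * (B ^+ a - B ^+ a.-1) = T * (1 - (B / Q) ^+ n).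
Proof.
have Q0 : Q != 0 by rewrite gt_eqF // (lt_trans B0).
have QB : Q - B != 0 by rewrite gt_eqF // subr_gt0.
elim: n => [|n IH]; first by rewrite big_geq // expr0 subrr mulr0.
rewrite big_nat_recr //= IH /walsh_coef powR_frac; last first.
  by rewrite divr_ge0 ?exprn_ge0 ?mulr_ge0 ?subr_ge0 ?(ltW B0) // ltW.
rewrite /T !expr_div_n !exprS; set k := _ `^ lambda.
by field; rewrite Q0 QB !expf_neq0.
Qed.

Let alias_powR : alias_coef `^ lambda * B ^+ m = phi0 `^ lambda * (B / Q) ^+ m.
Proof. by rewrite powR_frac ?(ltW phi0_gt0) // expr_div_n; ring. Qed.

Let BQm : 0 <= (B / Q) ^+ m <= 1.
Proof.
have Q0 : 0 < Q by exact: lt_trans BQ.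
by rewrite exprn_ge0 ?exprn_ile1 ?divr_ge0 ?ler_pdivrMr ?mul1r ?ltW.
Qed.

(** With y = (B / Q)^m the left side equals y phi0^lambda + (1 - y) T, a convex combination of the
    two entries of the maximum. *)
Lemma sum_powR_walsh_coef :
  alias_coef `^ lambda * B ^+ m
  + \sum_(1 <= a < m.+1) walsh_coef a `^ lambda * (B ^+ a - B ^+ a.-1)
  <= Ctilde b alpha d lambda.
Proof.
rewrite alias_powR sum_T; have /andP[y0 y1] := BQm.
have -> : Ctilde b alpha d lambda =
    Ctilde b alpha d lambda * (B / Q) ^+ m + Ctilde b alpha d lambda * (1 - (B / Q) ^+ m).
  by ring.
by rewrite lerD // ler_wpM2r ?subr_ge0 ?phi0_powR_le.
Qed.

(** This is the condition on the zero frequency in [average_dilates]. *)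
Lemma alias_coef_le : (b ^ m).-1%:R * alias_coef `^ lambda <= Ctilde b alpha d lambda.
Proof.
apply: le_trans phi0_powR_le; have /andP[y0 y1] := BQm.
apply: le_trans (_ : phi0 `^ lambda * (B / Q) ^+ m <= _).
  by rewrite -alias_powR mulrC ler_wpM2l ?powR_ge0 // -natrX ler_nat leq_pred.
by rewrite ler_piMr ?powR_ge0.
Qed.

End PowerSum.
End PhiExpansion.

(** * The polynomial lattice as a function on the residue field *)

Lemma digit_poly_inj (b m n n' : nat) : prime b -> (n < b ^ m)%N -> (n' < b ^ m)%N ->
  digit_poly b m n = digit_poly b m n' -> n = n'.
Proof.
move=> pb nm nm' eq_nn'.
have mod_eq k : (k <= m)%N -> n = n' %[mod b ^ k].
  elim: k => [|k IH] km; first by rewrite !modn1.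
  have step (u : nat) : (u %% b ^ k.+1 = u %/ b ^ k %% b * b ^ k + u %% b ^ k)%N.
    by rewrite modn_divl -expnS {1}(divn_eq (u %% b ^ k.+1) (b ^ k)) modn_dvdm // dvdn_exp2l.
  rewrite !step (IH (ltnW km)); congr (_ * _ + _)%N.
  have := congr1 (fun q : {poly 'F_b} => nat_of_ord q`_k) eq_nn'.
  by rewrite !coef_poly km !val_Fp_nat // !modn_mod.
by have := mod_eq m (leqnn m); rewrite !modn_small.
Qed.

Section LatticeFunction.
Variables (R : realType) (b m alpha d : nat) (p : {poly 'F_b}).
Variables (K : finFieldType) (red : {rmorphism {poly 'F_b} -> K}) (rep : K -> {poly 'F_b}).
Hypotheses (hb : prime b) (hm : (0 < m)%N) (hdeg : size p = m.+1).
Hypotheses (halpha : (0 < alpha)%N) (hd : (0 < d)%N).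
Hypotheses (repK : cancel rep red) (redK : forall a, rep (red a) = a %% p).

Definition lattice_fun (y : K) : R := phi b alpha d (v_map R m (laurent_div (rep y) p)).

(** The map v_m reads only digits at positive places, so a coordinate sees n q_i only modulo [p]. *)
Lemma phi_lattice_coord (qs : seq {poly 'F_b}) n i :
  phi b alpha d (lattice_coord R m p qs n i)
  = lattice_fun (red (digit_poly b m n) * red qs`_i.-1).
Proof.
rewrite /lattice_fun -rmorphM redK /lattice_coord /v_map; congr phi.
rewrite big_nat [RHS]big_nat; apply: eq_bigr => l /andP[l0 _].
by congr ((nat_of_ord _)%:R / _); apply/esym/(digit_modp hdeg).
Qed.

(** The polynomials n(x) are b^m distinct polynomials of degree less than m, hence a complete
    residue system. *)
Lemma sum_digit_poly (G : K -> R) :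
  \sum_(0 <= n < b ^ m) G (red (digit_poly b m n)) = \sum_y G y.
Proof.
rewrite big_mkord [RHS](reindex (fun n : 'I_(b ^ m) => red (digit_poly b m n))) //.
apply: onW_bij; apply: inj_card_bij => [n n' /(congr1 rep)|].
  rewrite !(red_small hdeg redK) ?size_poly //.
  by move/(digit_poly_inj hb (ltn_ord n) (ltn_ord n'))/val_inj.
by rewrite card_ord (card_residue_field hb hdeg repK redK).
Qed.

Variables (C : fieldType) (iota : {rmorphism R -> C}) (zeta : C).
Hypothesis zeta_prim : b.-primitive_root zeta.

(** On m-digit points the indices k + l b^m with l > 0 give the same character as k. Walsh
    coefficients depend only on the number of digits, so every k receives the same alias term. *)
Definition lattice_coef (k : K) : R :=
  (if k == 0 then 0 else walsh_coef R b alpha d (size (rep k))) + alias_coef R b m alpha d.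

Lemma expansion_lattice_fun : expansion iota (psi p rep zeta) lattice_fun lattice_coef.
Proof.
have b1 := prime_gt1 hb; split=> [k|y].
  rewrite addr_ge0 ?(ltW (alias_coef_gt0 _ _ _ _ _)) //; case: eqP => // _.
  exact/ltW/walsh_coef_gt0.
have digit_lt l : (digit p l (rep y) < b)%N by rewrite -[X in (_ < X)%N](Fp_cast hb) ltn_ord.
have -> : lattice_fun y = _ := phi_digits R m b1 halpha hd digit_lt.
rewrite /lattice_coef.
under [RHS]eq_bigr do rewrite rmorphD mulrDl.
rewrite big_split -mulr_sumr rmorphD; congr (_ + _); last first.
  rewrite rmorphM rmorph_nat /=; congr (_ * _).
  rewrite -(psi_sum_small hb hdeg repK redK zeta_prim) //.
  by apply: eq_bigl => k; rewrite (size_rep hdeg repK redK).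
rewrite (bigD1 0) //= eqxx rmorph0 mul0r add0r rmorph_sum /=.
under [RHS]eq_bigr => k /negPf-> do [].
rewrite (sum_by_size hdeg repK redK (fun a => iota (walsh_coef R b alpha d a))).
rewrite big_nat [RHS]big_nat; apply: eq_bigr => a /andP[_ am].
rewrite rmorphM rmorphB !rmorph_nat !(psi_sum_small hb hdeg repK redK zeta_prim) //.
exact: leq_trans (leq_pred a) _.
Qed.

Variable lambda : R.
Hypotheses (lam_gt : 1 / (2 * minn alpha d + 1)%:R < lambda) (lam_le1 : lambda <= 1).

(** Subadditivity separates the two terms of each coefficient; the alias term then occurs b^m times
    in all. *)
Lemma sum_powR_lattice_coef : \sum_k lattice_coef k `^ lambda <= Ctilde b alpha d lambda.
Proof.
have b1 := prime_gt1 hb.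
apply: le_trans (sum_powR_walsh_coef m b1 halpha hd lam_gt).
have a0 := ltW (alias_coef_gt0 R m b1 halpha hd).
rewrite -natrX -(card_residue_field hb hdeg repK redK) mulr_natr -sumr_const.
rewrite [X in _ <= X + _](bigD1 0) //= (bigD1 0) //= -addrA lerD //.
  by rewrite /lattice_coef eqxx add0r.
have <- : \sum_(k | k != 0) walsh_coef R b alpha d (size (rep k)) `^ lambda * 1 =
   \sum_(1 <= a < m.+1) walsh_coef R b alpha d a `^ lambda * (b%:R ^+ a - b%:R ^+ a.-1).
  rewrite (sum_by_size hdeg repK redK (fun a => walsh_coef R b alpha d a `^ lambda)).
  rewrite big_nat [RHS]big_nat; apply: eq_bigr => a /andP[_ am]; congr (_ * (_ - _)).
    by rewrite sumr_const (card_small_rep hb hdeg repK redK) // natrX.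
  by rewrite sumr_const (card_small_rep hb hdeg repK redK) ?natrX // (leq_trans (leq_pred a)).
rewrite -big_split; apply: ler_sum => k /negPf k0; rewrite /lattice_coef k0 mulr1 addrC.
by apply: powR_subadd => //; exact/ltW/walsh_coef_gt0.
Qed.

End LatticeFunction.

(** * Decomposition of the quality criterion *)

Section InitialSegments.
Variables (s : nat) (j : 'I_s).

Lemma initialS : initial s j.+1 = initial s j :|: [set j].
Proof. by apply/setP => i; rewrite !inE ltnS leq_eqVlt orbC (inj_eq val_inj). Qed.

Lemma notin_initial (u : {set 'I_s}) : u \subset initial s j -> j \notin u.
Proof. by move=> /subsetP uj; apply/negP => /uj; rewrite inE ltnn. Qed.

Lemma sum_with_last (V : nmodType) (F : {set 'I_s} -> V) :
  \sum_(v : {set 'I_s} | ([set j] \subset v) && (v \subset initial s j.+1)) F v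
  = \sum_(u : {set 'I_s} | u \subset initial s j) F (u :|: [set j]).
Proof.
rewrite (reindex_onto (fun u => u :|: [set j]) (fun v => v :\ j)) /=; last first.
  by move=> v /andP[jv _]; rewrite setUC setD1K // -sub1set.
apply: eq_bigl => u; rewrite subsetUr /= initialS.
apply/andP/idP => [[uj /eqP<-]|uj].
  by rewrite subDset [_ :|: initial _ _]setUC.
split; first exact: setSU.
by rewrite setUC setU1K ?notin_initial.
Qed.

Lemma sum_initialS (V : nmodType) (F : {set 'I_s} -> V) :
  \sum_(v : {set 'I_s} | (v != set0) && (v \subset initial s j.+1)) F v
  = \sum_(v : {set 'I_s} | (v != set0) && (v \subset initial s j)) F v
    + \sum_(u : {set 'I_s} | u \subset initial s j) F (u :|: [set j]).
Proof.
rewrite (bigID (fun v : {set 'I_s} => j \in v)) /= addrC -sum_with_last.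
congr (_ + _); apply: eq_bigl => v; rewrite ?sub1set.
  case: (boolP (j \in v)) => jv; rewrite ?andbF ?andbT /=.
    by apply/esym/negbTE; rewrite negb_and (contraL (@notin_initial v)) ?orbT.
  by rewrite initialS setUC -subDset (setDidPl _) // disjoint_sym disjoints1.
case: (boolP (j \in v)) => jv; rewrite ?andbF ?andbT //=.
by case: eqVneq jv => // ->; rewrite inE.
Qed.

End InitialSegments.

Section Criterion.
Variables (R : realType) (b m s d alpha : nat) (gamma : {set 'I_s} -> R).
Hypothesis d_gt0 : (0 < d)%N.

Local Notation D := (Dconst R b alpha d).

(* Below, [g i] stands for phi (z_i). *)
Definition phi_block (g : nat -> R) (j a : nat) : R :=
  - 1 + \prod_(1 <= k < a.+1) (1 + g (j * d + k)%N).

Definition lower_sum (g : nat -> R) (j : nat) : R :=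
  \sum_(v : {set 'I_s} | (v != set0) && (v \subset initial s j))
    gamma v * D ^+ #|v| * \prod_(i in v) phi_block g i d.

Definition upper_sum (g : nat -> R) (j : 'I_s) : R :=
  \sum_(u : {set 'I_s} | u \subset initial s j)
    gamma (u :|: [set j]) * D ^+ #|u|.+1 * \prod_(i in u) phi_block g i d.

(** The criterion is affine in the block under construction, so a new component enters linearly. *)
Definition integrand (g : nat -> R) (j : 'I_s) (a : nat) : R :=
  lower_sum g j + upper_sum g j * phi_block g j a.

Lemma phi_block0 g j : phi_block g j 0 = 0.
Proof. by rewrite /phi_block big_geq // addNr. Qed.

Lemma phi_blockS g j a :
  phi_block g j a.+1 = phi_block g j a + (1 + phi_block g j a) * g (j * d + a.+1)%N.
Proof. by rewrite /phi_block big_nat_recr //=; ring. Qed.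

(** A completed block is absorbed into the lower sum; this carries the induction to the next
    block. *)
Lemma lower_sumS g (j : 'I_s) : lower_sum g j.+1 = integrand g j d.
Proof.
rewrite /lower_sum sum_initialS; congr (_ + _); rewrite mulr_suml.
apply: eq_bigr => u /notin_initial ju.
by rewrite setUC cardsU1 ju big_setU1 //=; ring.
Qed.

Lemma eq_phi_block g g' j a : (forall k, (0 < k <= a)%N -> g (j * d + k)%N = g' (j * d + k)%N) ->
  phi_block g j a = phi_block g' j a.
Proof.
by move=> gg; rewrite /phi_block big_nat [in RHS]big_nat; congr (_ + _);
   apply: eq_bigr => k /gg->.
Qed.

Lemma eq_phi_block_initial g g' (j : 'I_s) (v : {set 'I_s}) :
  (forall i, (0 < i <= j * d)%N -> g i = g' i) -> v \subset initial s j ->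
  \prod_(i in v) phi_block g i d = \prod_(i in v) phi_block g' i d.
Proof.
move=> gg /subsetP vj; apply: eq_bigr => i /vj; rewrite inE => ij.
apply: eq_phi_block => k /andP[k0 kd]; apply: gg; rewrite addn_gt0 k0 orbT.
apply: leq_trans (_ : i.+1 * d <= _)%N.
  by rewrite mulSn addnC leq_add2r.
by rewrite leq_mul2r ij orbT.
Qed.

Lemma eq_lower_sum g g' (j : 'I_s) : (forall i, (0 < i <= j * d)%N -> g i = g' i) ->
  lower_sum g j = lower_sum g' j.
Proof.
by move=> gg; apply: eq_bigr => v /andP[_ vj]; rewrite (eq_phi_block_initial gg vj).
Qed.

Lemma eq_upper_sum g g' (j : 'I_s) : (forall i, (0 < i <= j * d)%N -> g i = g' i) ->
  upper_sum g j = upper_sum g' j.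
Proof. by move=> gg; apply: eq_bigr => v vj; rewrite (eq_phi_block_initial gg vj). Qed.

Lemma Bcrit_integrand (p : {poly 'F_b}) (qs : seq {poly 'F_b}) (j : 'I_s) a :
  (0 < a <= d)%N -> size qs = (j * d + a)%N ->
  Bcrit m d alpha gamma qs p = (b%:R ^+ m)^-1 * \sum_(0 <= n < b ^ m)
    integrand (fun i => phi b alpha d (lattice_coord R m p qs n i)) j a.
Proof.
move=> /andP[a0 ad] sz; rewrite /Bcrit sz.
(* The numerator is (j + 1) d plus a - 1, and a - 1 < d. *)
have -> : ((j * d + a + d - 1) %/ d = j.+1)%N.
  rewrite (_ : (_ - 1)%N = (j.+1 * d + a.-1)%N); last first.
    by rewrite mulSn -addnBA // -subn1; lia.
  by rewrite divnMDl // divn_small ?addn0 // prednK.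
have -> : [set i : 'I_s | i.+1 == j.+1] = [set j] by apply/setP => i; rewrite !inE eqSS.
rewrite subn1 /= addKn -mulrDr -big_split /=; congr (_ * _); apply: eq_bigr => n _.
congr (_ + _); rewrite sum_with_last /upper_sum mulr_suml; apply: eq_bigr => u /notin_initial ju.
by rewrite setUC setU1K // cardsU1 ju.
Qed.

End Criterion.

(** * Induction on the components *)

Section Induction.
Variables (R : realType) (b m s d alpha : nat) (gamma : {set 'I_s} -> R).
Hypotheses (hb : prime b) (hm : (0 < m)%N) (hd : (0 < d)%N) (halpha : (0 < alpha)%N).
Hypothesis hgamma : forall u, 0 <= gamma u.
Variables (p : {poly 'F_b}) (K : finFieldType).
Variables (red : {rmorphism {poly 'F_b} -> K}) (rep : K -> {poly 'F_b}).
Hypotheses (hdeg : size p = m.+1) (repK : cancel rep red).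
Hypothesis redK : forall a, rep (red a) = a %% p.
Variables (C : fieldType) (iota : {rmorphism R -> C}) (zeta : C).
Hypothesis zeta_prim : b.-primitive_root zeta.
Variable lambda : R.
Hypotheses (lam_gt : 1 / (2 * minn alpha d + 1)%:R < lambda) (lam_le1 : lambda <= 1).

Local Notation f := (lattice_fun R m alpha d p rep).
Local Notation spec := (spectral iota (psi p rep zeta) lambda).
Local Notation D := (Dconst R b alpha d).
Local Notation Ct := (Ctilde b alpha d lambda).
Local Notation Cc := (Cconst b alpha d lambda).

Let b1 : (1 < b)%N. Proof. exact: prime_gt1. Qed.
Let lam0 : 0 < lambda. Proof. by apply: le_lt_trans lam_gt; rewrite divr_ge0. Qed.
Let lam01 : 0 < lambda <= 1. Proof. by rewrite lam0 lam_le1. Qed.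
Let psiD' := psiD hb hdeg repK redK zeta_prim.
Let psi0' := psi0 hdeg redK zeta.
Let psi_orth' := psi_orth hb hm hdeg repK redK zeta_prim.
Let D0 : 0 <= D. Proof. by rewrite mulr_ge0 ?exprn_ge0. Qed.
Let Ct0 : 0 <= Ct. Proof. by rewrite le_max powR_ge0. Qed.

Definition coord_fun (qs : seq {poly 'F_b}) (y : K) (i : nat) : R := f (y * red qs`_i.-1).

Lemma Bcrit_mean qs (j : 'I_s) a : (0 < a <= d)%N -> size qs = (j * d + a)%N ->
  Bcrit m d alpha gamma qs p = mean (fun y => integrand b d alpha gamma (coord_fun qs y) j a).
Proof.
move=> ad sz; rewrite (Bcrit_integrand _ _ _ hd p ad sz) /mean.
rewrite (card_residue_field hb hdeg repK redK) natrX.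
rewrite -(sum_digit_poly hb hdeg repK redK
  (fun y => integrand b d alpha gamma (coord_fun qs y) j a)).
congr (_ * _); apply: eq_bigr => n _.
congr (integrand b d alpha gamma _ j a); apply: boolp.funext => i.
by rewrite (phi_lattice_coord _ _ _ hdeg redK).
Qed.


(** A nonzero component gives a dilate of [lattice_fun]. A zero one, including the default beyond
    the end of [qs], gives the constant phi(0), covered by the first entry of the maximum. *)
Lemma spectral_coord qs i : spec (fun y => coord_fun qs y i) Ct.
Proof.
rewrite /coord_fun; set x := red _; have [->|x0] := eqVneq x 0.
  apply: spectral_weaken (phi0_powR_le b alpha d lambda) _.
  apply: eq_spectral (spectral_cst iota psi0' lam01 (ltW (phi0_gt0 R b1 halpha hd))) => y.
  rewrite mulr0 /lattice_fun (rep0 hdeg redK) -(phi_at0 R b alpha d); congr phi.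
  by rewrite /v_map big1 // => l _; rewrite /= mul0r div0p coef0 mul0r.
apply: (spectral_dilate x0); exists (lattice_coef R m alpha d rep).
  exact: (expansion_lattice_fun hb hdeg halpha hd repK redK iota zeta_prim).
exact: (sum_powR_lattice_coef hb hdeg halpha hd repK redK lam_gt lam_le1).
Qed.

(** The definition of a block subtracts 1, but the recurrence [phi_blockS] only adds and multiplies,
    so it preserves nonnegative coefficients. *)
Lemma spectral_phi_block qs (j a : nat) :
  spec (fun y => phi_block d (coord_fun qs y) j a) (- 1 + (1 + Ct) ^+ a).
Proof.
elim: a => [|a IH].
  have -> : - 1 + (1 + Ct) ^+ 0 = 0 by rewrite expr0 addNr.
  by apply: eq_spectral (spectral0 iota psi0' lam01) => y; rewrite phi_block0.
have sc := spectral_coord qs (j * d + a.+1).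
have := spectralD lam01 IH (spectralD lam01 (spectralM psiD' lam01 IH sc) sc).
have <- : - 1 + (1 + Ct) ^+ a + ((- 1 + (1 + Ct) ^+ a) * Ct + Ct) = - 1 + (1 + Ct) ^+ a.+1.
  by rewrite exprS; ring.
by apply: eq_spectral => y; rewrite phi_blockS; ring.
Qed.

Lemma spectral_phi_block1 qs (j a : nat) :
  spec (fun y => 1 + phi_block d (coord_fun qs y) j a) ((1 + Ct) ^+ a).
Proof.
have s1 := spectral_cst iota psi0' lam01 (ler01 : 0 <= 1 :> R); rewrite powR1 in s1.
apply: spectral_weaken (spectralD lam01 s1 (spectral_phi_block qs j a)).
by rewrite addrA subrr add0r.
Qed.

Let powR_weight (u : {set 'I_s}) k :
  (gamma u * D ^+ k) `^ lambda = gamma u `^ lambda * (D `^ lambda) ^+ k.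
Proof.
by rewrite powRM ?exprn_ge0 // -powR_mulrn // powRAC powR_mulrn ?powR_ge0.
Qed.

Let prod_Cc (u : {set 'I_s}) :
  (D `^ lambda) ^+ #|u| * \prod_(i in u) (- 1 + (1 + Ct) ^+ d) = Cc d ^+ #|u|.
Proof. by rewrite prodr_const -exprMn. Qed.

Lemma spectral_lower_sum qs (j : nat) :
  spec (fun y => lower_sum b d alpha gamma (coord_fun qs y) j)
    (\sum_(u : {set 'I_s} | (u != set0) && (u \subset initial s j))
       gamma u `^ lambda * Cc d ^+ #|u|).
Proof.
apply: (spectral_sum psi0' lam01) => u _; rewrite -prod_Cc mulrA -powR_weight.
apply: (spectralM psiD' lam01); first by apply: spectral_cst => //; rewrite mulr_ge0 ?exprn_ge0.
by apply: (spectral_prod psiD' psi0' lam01) => i _; exact: spectral_phi_block.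
Qed.

Definition upper_bound (j : 'I_s) : R :=
  \sum_(u : {set 'I_s} | u \subset initial s j)
    gamma (u :|: [set j]) `^ lambda * Cc d ^+ #|u|.

Lemma spectral_upper_sum qs (j : 'I_s) :
  spec (fun y => upper_sum b d alpha gamma (coord_fun qs y) j)
    (D `^ lambda * upper_bound j).
Proof.
rewrite mulr_sumr; apply: (spectral_sum psi0' lam01) => u _.
rewrite mulrCA -prod_Cc (mulrA (D `^ lambda)) -exprS mulrA -powR_weight.
apply: (spectralM psiD' lam01); first by apply: spectral_cst => //; rewrite mulr_ge0 ?exprn_ge0.
by apply: (spectral_prod psiD' psi0' lam01) => i _; exact: spectral_phi_block.
Qed.

(** The factor of the new value of [phi] when one component is appended to [qs]. *)
Definition weight_fun qs (j : 'I_s) (a : nat) (y : K) : R :=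
  upper_sum b d alpha gamma (coord_fun qs y) j * (1 + phi_block d (coord_fun qs y) j a).

Lemma spectral_weight_fun qs j a :
  spec (weight_fun qs j a) (D `^ lambda * upper_bound j * (1 + Ct) ^+ a).
Proof.
by apply: (spectralM psiD' lam01); [exact: spectral_upper_sum | exact: spectral_phi_block1].
Qed.

Definition crit qs (j : 'I_s) (a : nat) : R :=
  mean (fun y => integrand b d alpha gamma (coord_fun qs y) j a).

Lemma crit_ge0 qs j a : 0 <= crit qs j a.
Proof.
apply: (spectral_mean_ge0 psi0' psi_orth'); apply: (spectralD lam01).
  exact: spectral_lower_sum.
by apply: (spectralM psiD' lam01); [exact: spectral_upper_sum | exact: spectral_phi_block].
Qed.

Definition increment qs j a (x : K) : R := mean (fun y => weight_fun qs j a y * f (y * x)).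

Lemma increment_ge0 qs j a (x : K) : 0 <= increment qs j a x.
Proof.
apply: (spectral_mean_ge0 psi0' psi_orth'); apply: (spectralM psiD' lam01).
  exact: spectral_weight_fun.
by have := spectral_coord [:: rep x] 1; rewrite /coord_fun /= repK; apply.
Qed.

Lemma crit_rcons qs x (j : 'I_s) a : size qs = (j * d + a)%N ->
  crit (rcons qs x) j a.+1 = crit qs j a + increment qs j a (red x).
Proof.
move=> sz; rewrite /crit /increment /mean -mulrDr -big_split; congr (_ * _).
apply: eq_bigr => y _ /=; rewrite /integrand phi_blockS.
have old i : (0 < i <= j * d + a)%N -> coord_fun (rcons qs x) y i = coord_fun qs y i.
  by case: i => // i /= ij; rewrite /coord_fun nth_rcons sz /= ij.
have old_j i : (0 < i <= j * d)%N -> coord_fun (rcons qs x) y i = coord_fun qs y i.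
  by move=> /andP[i0 ij]; apply: old; rewrite i0 (leq_trans ij) // leq_addr.
rewrite (eq_lower_sum _ _ _ old_j) (eq_upper_sum _ _ _ old_j).
rewrite (@eq_phi_block _ _ (coord_fun (rcons qs x) y) (coord_fun qs y)); last first.
  by move=> k /andP[k0 ka]; apply: old; rewrite addn_gt0 k0 orbT leq_add2l.
have -> : coord_fun (rcons qs x) y (j * d + a.+1)%N = f (y * red x).
  by rewrite /coord_fun addnS /= nth_rcons sz ltnn eqxx.
by rewrite /weight_fun; ring.
Qed.

Local Notation N := (#|K|.-1%:R : R).

Lemma increment_average qs j a :
  \sum_(x | x != 0) increment qs j a x `^ lambda
  <= D `^ lambda * upper_bound j * (1 + Ct) ^+ a * Ct.
Proof.
apply: (average_dilates psiD' psi0' psi_orth' lam01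
  (expansion_lattice_fun hb hdeg halpha hd repK redK iota zeta_prim)); last first.
- exact: spectral_weight_fun.
- apply: le_trans (sum_powR_lattice_coef hb hdeg halpha hd repK redK lam_gt lam_le1).
  by rewrite [leRHS](bigD1 0) //= lerDr powR_ge0.
- rewrite (card_residue_field hb hdeg repK redK) /lattice_coef eqxx add0r.
  exact: alias_coef_le.
Qed.

(** A minimum is at most the average over the [N] nonzero residues, and t |-> t^lambda is
    increasing. *)
Lemma increment_min qs j a (x : {poly 'F_b}) :
  (forall x' : K, x' != 0 -> increment qs j a (red x) <= increment qs j a x') ->
  N * increment qs j a (red x) `^ lambda
  <= D `^ lambda * upper_bound j * (1 + Ct) ^+ a * Ct.
Proof.
move=> xmin; apply: le_trans (increment_average qs j a).
rewrite -(cardC1 (0 : K)) mulr_natl -sumr_const; apply: ler_sum => x' x'0.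
by apply: ge0_ler_powR (xmin x' x'0); rewrite ?nnegrE ?increment_ge0 ?(ltW lam0).
Qed.

Definition bracket (j : 'I_s) (a : nat) : R :=
  (\sum_(u : {set 'I_s} | (u != set0) && (u \subset initial s j))
     gamma u `^ lambda * Cc d ^+ #|u|)
  + Cc a * upper_bound j.

Lemma bracketS j a :
  bracket j a.+1 = bracket j a + D `^ lambda * upper_bound j * (1 + Ct) ^+ a * Ct.
Proof. by rewrite /bracket /Cconst exprS; ring. Qed.

Lemma bracket_next (j j' : 'I_s) : j' = j.+1 :> nat -> bracket j' 0 = bracket j d.
Proof.
have C0 : Cc 0 = 0 by rewrite /Cconst expr0 addNr mulr0.
move=> jj; rewrite /bracket C0 mul0r addr0 jj sum_initialS.
congr (_ + _); rewrite mulr_sumr; apply: eq_bigr => u /notin_initial ju.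
by rewrite setUC cardsU1 ju /= exprS; ring.
Qed.

Lemma crit_next qs (j j' : 'I_s) : j' = j.+1 :> nat -> crit qs j' 0 = crit qs j d.
Proof.
move=> jj; rewrite /crit /mean; congr (_ * _); apply: eq_bigr => y _.
by rewrite {1}/integrand phi_block0 mulr0 addr0 jj lower_sumS.
Qed.

Variable q : (d * s).-tuple {poly 'F_b}.
Hypothesis hq : cbc_constructed m alpha gamma p q.

Lemma rep_Rbm (x : K) : x != 0 -> rep x \in Rbm b m.
Proof.
move=> x0; rewrite inE (size_rep hdeg repK redK) /=.
by apply: contraNneq x0 => rx; rewrite -(repK x) rx rmorph0.
Qed.

(** The old value of the criterion is independent of the new component, so minimizing the criterion
    minimizes the increment. *)
Lemma cbc_increment_min (j : 'I_s) a : (a < d)%N -> forall x : K, x != 0 ->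
  increment (take (j * d + a) q) j a (red q`_(j * d + a))
  <= increment (take (j * d + a) q) j a x.
Proof.
move=> ad x x0; have [q1 qmin] := hq.
have tau_lt : (j * d + a < d * s)%N.
  apply: leq_trans (_ : j.+1 * d <= _)%N; first by rewrite mulSn addnC ltn_add2r.
  by rewrite mulnC leq_mul2l ltn_ord orbT.
have [t0|t0] := posnP (j * d + a).
  have a0 : a = 0%N by move/eqP: t0; rewrite addn_eq0 => /andP[_ /eqP].
  rewrite t0 take0 q1 rmorph1 a0 /increment /mean.
  (* For tau = 1 the weight is constant, so every nonzero q_1 gives the same mean. *)
  suff -> : \sum_y weight_fun [::] j 0 y * f (y * 1)
      = \sum_y weight_fun [::] j 0 y * f (y * x) by [].
  (* In the empty sequence every component reads as the default 0, so no coordinate depends on y. *)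
  have wc y : weight_fun [::] j 0 y = weight_fun [::] j 0 0.
    rewrite /weight_fun; congr (upper_sum b d alpha gamma _ j * (1 + phi_block d _ j 0));
      by apply: boolp.funext => i; rewrite /coord_fun nth_nil rmorph0 !mulr0.
  rewrite (reindex_inj (mulIf x0)) /=; apply: eq_bigr => y _.
  by rewrite wc [in RHS]wc mulr1.
have [|_ /(_ _ (rep_Rbm x0))] := qmin (j * d + a).+1; first by rewrite ltnS t0.
have sz : size (take (j * d + a) q) = (j * d + a)%N by rewrite size_takel // size_tuple ltnW.
rewrite /= !(@Bcrit_mean _ j a.+1) ?size_rcons ?sz ?addnS //.
by rewrite -!/(crit _ _ _) !crit_rcons // repK lerD2l.
Qed.

Let initial0 (u : {set 'I_s}) : (u != set0) && (u \subset initial s 0) = false.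
Proof.
have -> : initial s 0 = set0 by apply/setP => i; rewrite !inE.
by rewrite subset0 andNb.
Qed.

Lemma crit_le_bracket (j : 'I_s) a : (a <= d)%N ->
  N * crit (take (j * d + a) q) j a `^ lambda <= bracket j a.
Proof.
(* Within one block, subadditivity lets the lambda-th power of the criterion grow by at most that of
   the increment. *)
have step (i : 'I_s) : N * crit (take (i * d) q) i 0 `^ lambda <= bracket i 0 ->
    forall a, (a <= d)%N -> N * crit (take (i * d + a) q) i a `^ lambda <= bracket i a.
  move=> base; elim=> [|c IH] cd; first by rewrite addn0.
  have tau_lt : (i * d + c < d * s)%N.
    apply: leq_trans (_ : i.+1 * d <= _)%N; first by rewrite mulSn addnC ltn_add2r.
    by rewrite mulnC leq_mul2l ltn_ord orbT.
  have sz : size (take (i * d + c) q) = (i * d + c)%N by rewrite size_takel // size_tuple ltnW.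
  rewrite addnS (take_nth 0) ?size_tuple // crit_rcons // bracketS.
  apply: le_trans (lerD (IH (ltnW cd)) (increment_min (cbc_increment_min i cd))).
  rewrite -[leRHS]mulrDr; apply: ler_wpM2l; first exact: ler0n.
  by apply: powR_subadd => //; [exact: crit_ge0 | exact: increment_ge0].
(* Induction over blocks: before the first component both sides are 0, and a full block is the empty
   start of the next. *)
move: a; case: j => j; elim: j => [|j IHj] js; apply: step => /=.
  rewrite /crit /bracket /mean /integrand /lower_sum /Cconst.
  under eq_bigr do rewrite phi_block0 mulr0 addr0 big_pred0 //.
  rewrite big1 // mulr0 powR0 ?gt_eqF // mulr0 big_pred0 // expr0 addNr mulr0 mul0r addr0.
  exact: lexx.
rewrite (@crit_next _ (Ordinal (ltnW js))) // (@bracket_next (Ordinal (ltnW js))) //.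
by rewrite mulSn addnC; apply: IHj.
Qed.

Lemma crit_bound (j : 'I_s) a : (a <= d)%N ->
  crit (take (j * d + a) q) j a
  <= 1 / (b%:R ^+ m - 1) `^ (1 / lambda) * bracket j a `^ (1 / lambda).
Proof.
move=> ad; have := crit_le_bracket j ad.
have c0 := crit_ge0 (take (j * d + a) q) j a; move: c0; set c := crit _ _ _ => c0.
have bm1 : (1 < b ^ m)%N by rewrite -(exp1n m) ltn_exp2r.
have -> : N = b%:R ^+ m - 1.
  by rewrite (card_residue_field hb hdeg repK redK) -subn1 natrB ?natrX // ltnW.
have N0 : 0 < b%:R ^+ m - 1 :> R by rewrite subr_gt0 -natrX ltr1n.
move=> cE; have E0 : 0 <= bracket j a by apply: le_trans cE; rewrite mulr_ge0 ?powR_ge0 ?ltW.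
have -> : c = (c `^ lambda) `^ (1 / lambda).
  by rewrite -powRrM mul1r divff ?gt_eqF // powRr1.
have -> : 1 / (b%:R ^+ m - 1) `^ (1 / lambda) = (b%:R ^+ m - 1)^-1 `^ (1 / lambda) :> R.
  by rewrite mul1r -(powR_inv1 (ltW N0)) powRAC powR_inv1 ?powR_ge0.
have [lam_ge0 N_ge0] := (ltW lam0, ltW N0).
rewrite -powRM ?invr_ge0 // ge0_ler_powR ?nnegrE ?powR_ge0 ?divr_ge0 ?mulr_ge0 ?invr_ge0 //.
by rewrite mulrC ler_pdivlMr // mulrC.
Qed.

End Induction.

Theorem theorem1 (R : realType) (b m s d alpha : nat)
    (hb : prime b) (hm : (0 < m)%N) (hs : (0 < s)%N) (hd : (0 < d)%N)
    (halpha : (0 < alpha)%N)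
    (gamma : {set 'I_s} -> R) (hgamma : forall u : {set 'I_s}, 0 <= gamma u)
    (p : {poly 'F_b}) (hp : irreducible_poly p) (hdeg : size p = m.+1)
    (q : (d * s).-tuple {poly 'F_b})
    (hq : cbc_constructed m alpha gamma p q) :
  forall tau : nat, (1 <= tau <= d * s)%N ->
  (* j is j_0 - 1, i.e. the element of 'I_s standing for j_0 *)
  forall (j : 'I_s) (d0 : nat), tau = (j * d + d0)%N -> (0 < d0 <= d)%N ->
  forall lambda : R, 1 / (2 * minn alpha d + 1)%:R < lambda -> lambda <= 1 ->
    Bcrit m d alpha gamma (take tau q) p <=
      1 / ((b%:R ^+ m - 1) `^ (1 / lambda)) *
      ((\sum_(u : {set 'I_s} | (u != set0) && (u \subset initial s j))
           gamma u `^ lambda * Cconst b alpha d lambda d ^+ #|u|)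
       + Cconst b alpha d lambda d0 *
         (\sum_(u : {set 'I_s} | u \subset initial s j)
           gamma (u :|: [set j]) `^ lambda * Cconst b alpha d lambda d ^+ #|u|))
      `^ (1 / lambda).
Proof.
move=> tau /andP[tau0 tau_le] j d0 tauE hd0 lambda lam_gt lam_le1.
have [K [red [rep [repK redK]]]] := residue_field hp.
(* Characters take values in the complex numbers over [R], which are algebraically closed and of
   characteristic 0. *)
have [|zeta zeta_prim] := @prime_primitive_root (complex R) b hb.
  by rewrite pnatr_eq0 -lt0n prime_gt0.
have sz : size (take tau q) = (j * d + d0)%N by rewrite -tauE size_takel ?size_tuple.
rewrite (Bcrit_mean _ _ hb hd hdeg repK redK hd0 sz) tauE.
case/andP: hd0 => _ hd0.
exact: (crit_bound hb hm hd halpha hgamma hdeg repK redK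
  (real_complex R : {rmorphism R -> complex R}) zeta_prim lam_gt lam_le1 hq j hd0).
Qed.
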